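(* Consider the iterates of AS-ALM and fix $k\ge0$ with $\eta_k\in(0,1/\nu)$. Then $\tilde w^k\in\Omega$ and for all $w=(x;\lambda)\in\Omega$, $$f(x)-f(x^{k+1})+\langle w-\tilde w^k,\mathcal J(w)\rangle\ge(w-\tilde w^k)^\top Q_k(w^k-\tilde w^k)+\zeta^k(x),\qquad Q_k=\begin{bmatrix}\mathcal D_k&0\\0&\frac1\beta I\end{bmatrix}.$$
   Context: Setting. $\mathcal X\subset\mathbb R^{n_1}$ is a nonempty closed convex set; $A\in\mathbb R^{n\times n_1}$, $b\in\mathbb R^n$; $f=\frac1N\sum_{j=1}^Nf_j$, each $f_j$ real-valued, convex and continuously differentiable on an open set containing $\mathcal X$. The problem is $\min\{f(x):Ax=b,\ x\in\mathcal X\}$. A fixed symmetric positive definite $H$ and a constant $\nu>0$ satisfy $\|\nabla f_j(x_1)-\nabla f_j(x_2)\|_{H^{-1}}\le\nu\|x_1-x_2\|_H$ for all $x_1,x_2\in\mathcal X$ and all $j$. For symmetric $G$, $\|v\|_G^2:=v^\top Gv$; $G_1\succeq G_2$ means $G_1-G_2$ is positive semidefinite. Subroutine xsub. Inputs: $x^k\in\mathcal X$, $\breve x^k$, $h\in\mathbb R^{n_1}$, an integer $m_k\ge1$, $\eta_k>0$, a symmetric matrix $M_k$. Set $x_1=x^k$, $\breve x_1=\breve x^k$. For $t=1,\dots,m_k$: draw $\xi_t$ uniformly from $\{1,\dots,N\}$, independently of everything generated before; set $\beta_t=2/(t+1)$, $\gamma_t=2/(t\eta_k)$, $\hat x_t=\beta_t\breve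 x_t+(1-\beta_t)x_t$, $d_t=\nabla f_{\xi_t}(\hat x_t)+e_t$ where $e_t$ is a random vector whose conditional expectation given all previously generated random quantities and $\xi_t$ is $0$; $\breve x_{t+1}=\arg\min_{x\in\mathcal X}\{\langle d_t+h,x\rangle+\frac{\gamma_t}2\|x-\breve x_t\|_H^2+\frac12\|x-x^k\|_{M_k}^2\}$; $x_{t+1}=\beta_t\breve x_{t+1}+(1-\beta_t)x_t$. Output $x^{k+1}=x_{m_k+1}$, $\breve x^{k+1}=\breve x_{m_k+1}$. Put $\delta_t=\nabla f(\hat x_t)-d_t$ (inner quantities of outer iteration $k$), and for $x\in\mathcal X$ $$\zeta^k(x)=\frac{2}{m_k(m_k+1)}\Big[\frac1{\eta_k}\big(\|x-\breve x^{k+1}\|_H^2-\|x-\breve x^k\|_H^2\big)-\sum_{t=1}^{m_k}t\langle\delta_t,\breve x_t-x\rangle-\frac{\eta_k}{4(1-\eta_k\nu)}\sum_{t=1}^{m_k}t^2\|\delta_t\|_{H^{-1}}^2\Big].$$ Algorithm AS-ALM. Parameters: $\beta>0$, $s\in(0,2]$, the matrix $H$. Start: $(x^0,\lambda^0)\in\mathcal X\times\mathbb R^n$, $\breve x^0=x^0$. For $k=0,1,\dots$: choose an integer $m_k\ge1$, $\eta_k>0$ and a symmetric $M_k$ with $\mathcal D_k:=M_k-\beta A^\top A\succeq0$; set $h^k=-A^\top[\lambda^k-\beta(Ax^k-b)]$; compute $(x^{k+1},\breve x^{k+1})$ by xsub with inputs $x^k,\breve x^k,h^k,m_k,\eta_k,M_k$;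 $\lambda^{k+1}=\lambda^k-s\beta(Ax^{k+1}-b)$. Notation. $\Omega=\mathcal X\times\mathbb R^n$; $w=(x;\lambda)$; $\mathcal J(w)=(-A^\top\lambda;\,Ax-b)$; $w^k=(x^k;\lambda^k)$; $\tilde\lambda^k=\lambda^k-\beta(Ax^{k+1}-b)$; $\tilde w^k=(x^{k+1};\tilde\lambda^k)$. *)

(* Defs.v *)
From HB Require Import structures.
From mathcomp Require Import all_boot all_order all_algebra.
From mathcomp Require Import all_classical all_reals all_analysis.
Set Implicit Arguments. Unset Strict Implicit. Unset Printing Implicit Defensive.
Import Order.TTheory GRing.Theory Num.Theory.
Import numFieldNormedType.Exports.
Local Open Scope ring_scope.
Local Open Scope classical_set_scope.

Section Defs.
Variable R : realType.

Definition inner (p : nat) (u v : 'cV[R]_p) : R := (u^T *m v) 0 0.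

Definition sqnorm (p : nat) (G : 'M[R]_p) (v : 'cV[R]_p) : R := (v^T *m G *m v) 0 0.

Definition mnorm (p : nat) (G : 'M[R]_p) (v : 'cV[R]_p) : R := Num.sqrt (sqnorm G v).

Definition symmetric_mx (p : nat) (G : 'M[R]_p) : Prop := G^T = G.

Definition psd_mx (p : nat) (G : 'M[R]_p) : Prop := forall v, 0 <= sqnorm G v.

Definition posdef_mx (p : nat) (G : 'M[R]_p) : Prop :=
  forall v : 'cV[R]_p, v != 0 -> 0 < sqnorm G v.

Definition convex_fun_on (p : nat) (X : set 'cV[R]_p) (f : 'cV[R]_p -> R) : Prop :=
  forall x y a, X x -> X y -> 0 <= a -> a <= 1 ->
    f (a *: x + (1 - a) *: y) <= a * f x + (1 - a) * f y.

Definition C1_with_grad (p : nat) (U : set 'cV[R]_p) (f : 'cV[R]_p -> R)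
    (g : 'cV[R]_p -> 'cV[R]_p) : Prop :=
  (forall x, U x -> differentiable f x /\ forall v, 'd f x v = inner (g x) v) /\
  {within U, continuous g}.

End Defs.

(* Main.v *)
(* Accelerated stochastic gradient argument.  With psi(u) = <h + M (u - x^k), z - u>,
   which is concave because M is psd, one inner step combines the quadratic upper
   bound of f at hx_t, the tangent inequalities of f at hx_t towards x_t and z, and
   the first-order optimality of the proximal subproblem into a recursion for the gap
   f(x_t) - f(z) - psi(x_t).  Multiplied by t (t + 1) / 2 it telescopes; the cross
   term t <delta_t, bx_(t+1) - bx_t> is absorbed by Young's inequality with constant
   (1 - eta nu) / eta.  Finally, psi(x^(k+1)) equals <w - wt, J w> minus the Q_k
   term, since J is affine with skew-symmetric linear part. *)
Require Import Defs.
From HB Require Import structures.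
From mathcomp Require Import all_boot all_order all_algebra.
From mathcomp Require Import all_classical all_reals all_analysis.
From mathcomp Require Import ring lra.
Import Order.TTheory GRing.Theory Num.Theory.
Import numFieldNormedType.Exports.
Local Open Scope ring_scope.
Local Open Scope classical_set_scope.

Set Implicit Arguments.
Unset Strict Implicit.

(** * Bilinearity of the inner product and positive definite matrices *)

Section InnerProduct.
Context {R : realType} {p : nat}.
Implicit Types (u v w : 'cV[R]_p) (G H : 'M[R]_p).

Lemma innerC u v : inner u v = inner v u.
Proof.
by rewrite /inner -[in LHS](trmxK v) -trmx_mul mxE.
Qed.

Lemma innerDl u v w : inner (u + v) w = inner u w + inner v w.
Proof. by rewrite /inner linearD mulmxDl mxE. Qed.

Lemma innerNl u w : inner (- u) w = - inner u w.
Proof. by rewrite /inner linearN mulNmx mxE. Qed.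

Lemma innerZl (c : R) u w : inner (c *: u) w = c * inner u w.
Proof. by rewrite /inner linearZ -scalemxAl mxE. Qed.

Lemma innerDr u v w : inner w (u + v) = inner w u + inner w v.
Proof. by rewrite innerC innerDl !(innerC w). Qed.

Lemma innerNr u w : inner w (- u) = - inner w u.
Proof. by rewrite innerC innerNl innerC. Qed.

Lemma inner_ge0 u : 0 <= inner u u.
Proof.
by rewrite /inner mxE sumr_ge0 // => i _; rewrite mxE -expr2 sqr_ge0.
Qed.

Lemma innerZr (c : R) u w : inner w (c *: u) = c * inner w u.
Proof. by rewrite innerC innerZl innerC. Qed.

Lemma inner_suml (I : finType) (F : I -> 'cV[R]_p) w :
  inner (\sum_i F i) w = \sum_i inner (F i) w.
Proof. by rewrite /inner linear_sum mulmx_suml summxE. Qed.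

Lemma sqnormE G v : sqnorm G v = inner v (G *m v).
Proof. by rewrite /sqnorm /inner mulmxA. Qed.

Lemma sqnormZ G (c : R) v : sqnorm G (c *: v) = c ^+ 2 * sqnorm G v.
Proof. by rewrite !sqnormE -scalemxAr innerZl innerZr mulrA. Qed.

Lemma sqnormDl G1 G2 v : sqnorm (G1 + G2) v = sqnorm G1 v + sqnorm G2 v.
Proof. by rewrite !sqnormE mulmxDl innerDr. Qed.

Lemma posdef_psd H : posdef_mx H -> psd_mx H.
Proof.
move=> Hpd v; have [->|/Hpd/ltW//] := eqVneq v 0.
by rewrite /sqnorm mulmx0 mxE.
Qed.

(** A kernel vector makes the quadratic form of [H] vanish, which positive definiteness allows only
    for zero. *)
Lemma posdef_unitmx H : posdef_mx H -> H \in unitmx.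
Proof.
move=> Hpd; rewrite -unitmx_tr -row_free_unit -kermx_eq0; apply/rowV0P => v.
move=> /sub_kermxP vH0; apply/eqP; case: (eqVneq v 0) => // v0.
have /Hpd : v^T != 0 by rewrite trmx_eq0.
rewrite sqnormE (_ : H *m v^T = 0); last first.
  by rewrite -[LHS]trmxK trmx_mul trmxK vH0 trmx0.
by rewrite /inner mulmx0 mxE ltxx.
Qed.

End InnerProduct.

Lemma inner_mulmxr (R : realType) (p q : nat) (B : 'M[R]_(p, q)) u v :
  inner u (B *m v) = inner (B^T *m u) v.
Proof. by rewrite /inner trmx_mul trmxK mulmxA. Qed.

Lemma inner_col_mx (R : realType) (p q : nat) (u u' : 'cV[R]_p) (v v' : 'cV_q) :
  inner (col_mx u v) (col_mx u' v') = inner u u' + inner v v'.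
Proof. by rewrite /inner tr_col_mx mul_row_col mxE. Qed.

(** * Symmetric forms, Young's inequality and dual norms *)

Section SymmetricForms.
Context {R : realType} {p : nat}.
Implicit Types (u v : 'cV[R]_p) (G H : 'M[R]_p).

Lemma inner_symC G u v : symmetric_mx G ->
  inner u (G *m v) = inner v (G *m u).
Proof. by move=> Gs; rewrite inner_mulmxr Gs innerC. Qed.

Lemma sqnormD G u v : symmetric_mx G ->
  sqnorm G (u + v) = sqnorm G u + 2 * inner u (G *m v) + sqnorm G v.
Proof.
move=> Gs; rewrite !sqnormE mulmxDr !innerDl !innerDr (inner_symC _ v) //; ring.
Qed.

Lemma sqnormB G u v : symmetric_mx G ->
  sqnorm G (u - v) = sqnorm G u - 2 * inner u (G *m v) + sqnorm G v.
Proof.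
move=> Gs; rewrite sqnormD // mulmxN innerNr (_ : sqnorm G (- v) = sqnorm G v).
  ring.
by rewrite -scaleN1r sqnormZ; ring.
Qed.

(** Expand the nonnegative square of [u - 2c H v] in the form of [invmx H] and divide by [4c]. That
    form is nonnegative because its value at [w] is the value of [H] at [invmx H *m w]. *)
Lemma inner_young H (c : R) u v : symmetric_mx H -> posdef_mx H -> 0 < c ->
  inner u v <= c * sqnorm H v + (4 * c)^-1 * sqnorm (invmx H) u.
Proof.
move=> Hs Hpd c0; have Hu := posdef_unitmx Hpd.
have Vs : symmetric_mx (invmx H) by rewrite /symmetric_mx trmx_inv Hs.
have : 0 <= sqnorm (invmx H) (u - (2 * c) *: (H *m v)).
  set w := u - _; rewrite -[w](mulKVmx Hu) sqnormE mulKmx // innerC -sqnormE.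
  exact: posdef_psd.
rewrite sqnormB // -scalemxAr mulKmx // innerZr sqnormZ.
rewrite (sqnormE _ (H *m v)) mulKmx // (innerC (H *m v)) -sqnormE.
move=> h.
rewrite -subr_ge0 (_ : _ - _ = (4 * c)^-1 * (sqnorm (invmx H) u - 2 *
  (2 * c * inner u v) + (2 * c) ^+ 2 * sqnorm H v)); last by field; lra.
by apply: mulr_ge0 => //; rewrite invr_ge0; lra.
Qed.

Lemma inner_lipschitz H (c : R) u v : symmetric_mx H -> posdef_mx H -> 0 < c ->
  mnorm (invmx H) u <= c * mnorm H v -> inner u v <= c * sqnorm H v.
Proof.
move=> Hs Hpd c0; rewrite /mnorm => h.
have V0 : 0 <= sqnorm (invmx H) u.
  rewrite -[u](mulKVmx (posdef_unitmx Hpd)) sqnormE mulKmx ?posdef_unitmx //.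
  by rewrite innerC -sqnormE; exact: posdef_psd.
have H0 : 0 <= sqnorm H v by exact: posdef_psd.
have {}h : sqnorm (invmx H) u <= c ^+ 2 * sqnorm H v.
  have := lerXn2r 2 (sqrtr_ge0 _) (mulr_ge0 (ltW c0) (sqrtr_ge0 _)) h.
  by rewrite exprMn !sqr_sqrtr.
(* With Young's constant [c / 2], the squared Lipschitz bound turns each of the two terms into
   [c / 2 * sqnorm H v]. *)
have c20 : 0 < c / 2 by lra.
apply: (le_trans (inner_young u v Hs Hpd c20)).
have -> : 4 * (c / 2) = 2 * c by field.
have -> : c * sqnorm H v = c / 2 * sqnorm H v + (2 * c)^-1 * (c ^+ 2 * sqnorm H v).
  by field; lra.
by rewrite lerD2l ler_wpM2l // invr_ge0; lra.
Qed.

End SymmetricForms.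

(** Replaces a limit as t tends to 0 from the right. If [a < 0], then [t = - a / (|q| - a)] lies in
    (0, 1] and makes [a + t q] negative. *)
Lemma ge0_affine_itv01 (R : realFieldType) (a q : R) :
  (forall t, 0 < t -> t <= 1 -> 0 <= a + t * q) -> 0 <= a.
Proof.
move=> h; rewrite leNgt; apply/negP => a0.
have q0 := normr_ge0 q; have qle := ler_norm q.
have d0 : 0 < `|q| - a by lra.
have t0 : 0 < - a / (`|q| - a) by apply: divr_gt0; lra.
have t1 : - a / (`|q| - a) <= 1 by rewrite ler_pdivrMr //; lra.
have := h _ t0 t1; rewrite leNgt => /negP; apply.
rewrite -(pmulr_llt0 _ d0) mulrDl mulrAC divfK ?gt_eqF //.
nra.
Qed.

Lemma convex_set_comb (R : realType) (p : nat) (X : set 'cV[R]_p) (t : R) u v :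
  convex_set X -> 0 <= t -> t <= 1 -> X u -> X v -> X (t *: u + (1 - t) *: v).
Proof.
move=> cX t0 t1 Xu Xv.
by have := cX u v (Itv01 t0 t1); rewrite !inE; apply.
Qed.

(** * First-order upper and lower bounds for smooth convex functions *)

Section Gradient.
Context {R : realType} {p : nat}.
Implicit Types (X U : set 'cV[R]_p) (f : 'cV[R]_p -> R) (g : 'cV[R]_p -> 'cV[R]_p).

Lemma is_derive_line f (a v gr : 'cV[R]_p) (t : R) :
  differentiable f (a + t *: v) ->
  (forall u, 'd f (a + t *: v) u = inner gr u) ->
  is_derive t 1 (fun r : R => f (a + r *: v)) (inner gr v).
Proof.
move=> fd fg.
have ld : is_diff t (fun r : R => a + r *: v) ( *:%R ^~ v).
  have -> : (fun r : R => a + r *: v) = cst a + *:%R ^~ v by [].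
  have := is_diffD (is_diff_cst a t) (is_diff_scalel t v).
  by rewrite add0r.
have ed : differentiable (fun r : R => a + r *: v) t by case: ld.
have dd : 'd (fun r : R => a + r *: v) t = *:%R ^~ v :> (R -> _) by case: ld.
split.
  by apply: diff_derivable; exact: (@differentiable_comp _ _ _ _ _ f).
rewrite deriveE; last exact: (@differentiable_comp _ _ _ _ _ f).
rewrite (@diff_comp _ _ _ _ _ f) //= dd.
by rewrite scale1r fg.
Qed.

(** The mean value theorem takes the place of integration: [phi] is f along the segment minus the
    linear and quadratic terms of the bound, and the Lipschitz condition makes its derivative
    nonpositive on (0, 1). *)
Lemma smooth_quadratic_bound X U f g H (nu : R) (a c : 'cV[R]_p) :
  convex_set X -> X `<=` U -> C1_with_grad U f g ->
  symmetric_mx H -> posdef_mx H -> 0 < nu ->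
  (forall x y, X x -> X y ->
     mnorm (invmx H) (g x - g y) <= nu * mnorm H (x - y)) ->
  X a -> X c -> f c <= f a + inner (g a) (c - a) + nu / 2 * sqnorm H (c - a).
Proof.
move=> cX XU [fg _] Hs Hpd nu0 lip Xa Xc.
set v := c - a.
have Xl (t : R) : t \in `[0, 1]%R -> X (a + t *: v).
  rewrite in_itv /= => /andP[t0 t1].
  have -> : a + t *: v = t *: c + (1 - t) *: a.
    by rewrite /v scalerBr scalerBl scale1r addrC -addrA (addrC (- _)).
  exact: convex_set_comb.
pose phi (r : R) :=
  f (a + r *: v) - (r * inner (g a) v + nu / 2 * sqnorm H v * (r * r)).
pose dphi (r : R) :=
  inner (g (a + r *: v)) v - (inner (g a) v + nu * sqnorm H v * r).
have phid (t : R) : t \in `[0, 1]%R -> is_derive t 1 phi (dphi t).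
  move=> /Xl /XU /fg [fd fgr].
  have ldf := is_derive_line fd fgr.
  apply: is_derive_eq.
  rewrite /GRing.scale /= /dphi; lra.
have oo_cc (t : R) : t \in `]0, 1[%R -> t \in `[0, 1]%R.
  by rewrite !in_itv /= => /andP[/ltW-> /ltW->].
have phic : {within `[0, 1], continuous phi}.
  by apply: derivable_within_continuous => t /phid [].
have [t t01] := MVT (@ltr01 R) (fun t t01 => phid t (oo_cc t t01)) phic.
have av : a + v = c by rewrite /v addrC subrK.
rewrite /phi /dphi scale0r scale1r addr0 av => e.
have : inner (g (a + t *: v) - g a) v <= nu * sqnorm H v * t.
  move: (t01); rewrite in_itv /= => /andP[t0 t1].
  have Xt : X (a + t *: v) := Xl t (oo_cc t t01).
  (* The Lipschitz condition concerns the displacement [t *: v], so it yields a factor t squared on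
     the right; one factor t then cancels. *)
  have : inner (g (a + t *: v) - g a) (t *: v) <= nu * sqnorm H (t *: v).
    apply: inner_lipschitz => //.
    by have := lip _ _ Xt Xa; rewrite addrAC subrr add0r.
  rewrite innerZr sqnormZ => h.
  rewrite -(ler_pM2l t0); apply: (le_trans h).
  by rewrite [leLHS](_ : _ = t * (nu * sqnorm H v * t)) //; ring.
rewrite innerDl innerNl => h; lra.
Qed.

(** By convexity every difference quotient along [c - a] with step in (0, 1] is at most [f c - f a];
    its right-hand limit is the directional derivative. *)
Lemma convex_above_tangent X U f g (a c : 'cV[R]_p) :
  X `<=` U -> C1_with_grad U f g -> convex_fun_on X f ->
  X a -> X c -> f a + inner (g a) (c - a) <= f c.
Proof.
move=> XU [fg _] cf Xa Xc.
set v := c - a.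
have [fd fgr] := fg _ (XU _ Xa).
have ldf : is_derive (0 : R) 1 (fun r : R => f (a + r *: v)) (inner (g a) v).
  by apply: is_derive_line; rewrite scale0r addr0.
rewrite addrC -lerBrDr -(@derive_val _ _ _ _ _ _ _ ldf).
apply: (cvgr_to_le (F := (0 : R)^'+)
  (cvg_dnbhs_at_right (@ex_derive _ _ _ _ _ _ _ ldf))).
near=> h; rewrite /= (_ : h%:A = h) ?addr0 ?scale0r; last exact: mulr1.
rewrite addr0.
have h0 : 0 < h by [].
have h1 : h <= 1 by near: h; apply: nbhs_right_le.
have -> : a + h *: v = h *: c + (1 - h) *: a.
  by rewrite /v scalerBr scalerBl scale1r addrC -addrA (addrC (- _)).
have := cf _ _ _ Xc Xa (ltW h0) h1 => fh.
by rewrite -[leLHS]/(h^-1 * _) mulrC ler_pdivrMr //; lra.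
Unshelve. all: by end_near.
Qed.

End Gradient.

(** * One accelerated proximal step *)

Section ProximalStep.
Context {R : realType} {p : nat}.
Implicit Types (X : set 'cV[R]_p) (H M : 'M[R]_p).

Let innerE := (@innerDl R p, @innerDr R p, @innerNl R p, @innerNr R p,
  @innerZl R p, @innerZr R p, @mulmxDr R, @mulmxN R).

(** Compare [u] with [u + t (z - u)]: the objective is quadratic, so its increment divided by t is
    exactly the directional derivative plus t times a constant. *)
Lemma prox_optimality X H M (gam : R) (l y x0 u z : 'cV[R]_p) :
  convex_set X -> symmetric_mx H -> symmetric_mx M ->
  let obj := fun w => inner l w + gam / 2 * sqnorm H (w - y)
                      + 1 / 2 * sqnorm M (w - x0) in
  X u -> (forall w, X w -> obj u <= obj w) -> X z ->
  0 <= inner (l + gam *: (H *m (u - y)) + M *m (u - x0)) (z - u).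
Proof.
move=> cX Hs Ms obj Xu umin Xz.
apply: (@ge0_affine_itv01 _ _
  (gam / 2 * sqnorm H (z - u) + 1 / 2 * sqnorm M (z - u))) => t t0 t1.
have := umin _ (convex_set_comb cX (ltW t0) t1 Xz Xu).
have -> : t *: z + (1 - t) *: u = u + t *: (z - u).
  by rewrite scalerBr scalerBl scale1r addrC -addrA (addrC (- _)).
rewrite /obj ![u + _ - _]addrAC !(sqnormD _ (t *: _)) // !sqnormZ.
rewrite innerDr !innerDl innerZl !(innerC (_ *m _)) -!scalemxAr.
rewrite !(inner_symC (z - u)) // !innerZr => h.
rewrite -(pmulr_rge0 _ t0) !innerDl; lra.
Qed.

(** Converts the gradient of the proximal term into squared distances, two of which telescope. *)
Lemma three_point H (y u z : 'cV[R]_p) : symmetric_mx H ->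
  2 * inner (H *m (u - y)) (z - u) =
  sqnorm H (z - y) - sqnorm H (z - u) - sqnorm H (u - y).
Proof.
move=> Hs; have -> : z - y = (z - u) + (u - y) by rewrite addrA subrK.
by rewrite sqnormD // innerC; ring.
Qed.

Lemma linearized_concave M (h x0 z u v : 'cV[R]_p) (b : R) :
  psd_mx M -> 0 <= b -> b <= 1 ->
  let psi := fun w => inner (h + M *m (w - x0)) (z - w) in
  b * psi u + (1 - b) * psi v <= psi (b *: u + (1 - b) *: v).
Proof.
move=> Mpsd b0 b1; set psi := fun _ => _; rewrite /= -subr_ge0.
(* [psi] is quadratic with leading form minus [M], so its concavity defect is known exactly. *)
have -> : psi (b *: u + (1 - b) *: v) - (b * psi u + (1 - b) * psi v) =
    b * (1 - b) * sqnorm M (u - v).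
  rewrite /psi sqnormE (innerC (u - v)) !innerE -!scalemxAr !innerE; ring.
by rewrite !mulr_ge0 // subr_ge0.
Qed.

Lemma accelerated_step X (F : 'cV[R]_p -> R) (G : 'cV[R]_p -> 'cV[R]_p) H M
    (nu b gam : R) (h d x0 x y y' z : 'cV[R]_p) :
  convex_set X -> symmetric_mx H -> symmetric_mx M -> psd_mx M ->
  (forall a c, X a -> X c ->
     F c <= F a + inner (G a) (c - a) + nu / 2 * sqnorm H (c - a)) ->
  (forall a c, X a -> X c -> F a + inner (G a) (c - a) <= F c) ->
  0 <= b -> b <= 1 -> X x -> X y -> X y' -> X z ->
  let obj := fun w => inner (d + h) w + gam / 2 * sqnorm H (w - y)
                      + 1 / 2 * sqnorm M (w - x0) in
  (forall w, X w -> obj y' <= obj w) ->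
  let hx := b *: y + (1 - b) *: x in
  let x' := b *: y' + (1 - b) *: x in
  let delta := G hx - d in
  let gap := fun w => F w - F z - inner (h + M *m (w - x0)) (z - w) in
  gap x' <= (1 - b) * gap x + b * (inner delta (y - z) + inner delta (y' - y)
    + gam / 2 * (sqnorm H (z - y) - sqnorm H (z - y') - sqnorm H (y' - y)))
    + nu / 2 * b ^+ 2 * sqnorm H (y' - y).
Proof.
move=> cX Hs Ms Mpsd smooth tangent b0 b1 Xx Xy Xy' Xz obj ymin.
set hx := b *: y + _; set x' := b *: y' + _.
set delta := G hx - d; set gap := fun _ => _; cbv zeta.
have Xhx : X hx by exact: convex_set_comb.
have Xx' : X x' by exact: convex_set_comb.
have c0 : 0 <= 1 - b by rewrite subr_ge0.
(* The two combinations share their [x] part, which is why the quadratic term of the smooth bound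
   carries [b ^+ 2]. *)
have xhx : x' - hx = b *: (y' - y).
  by rewrite /x' /hx opprD addrACA subrr addr0 -scalerBr.
have S := smooth _ _ Xhx Xx'.
rewrite xhx sqnormZ innerZr in S.
have T1 := ler_wpM2l c0 (tangent _ _ Xhx Xx).
have T2 := ler_wpM2l b0 (tangent _ _ Xhx Xz).
have O := mulr_ge0 b0 (prox_optimality cX Hs Ms Xy' ymin Xz).
have C := linearized_concave h x0 z y' x Mpsd b0 b1.
rewrite -/x' in C.
(* The weighted tangent directions add up to [b (z - y)]. Routing this through [y'] produces
   [b (y' - y)], which cancels the linear term of [S]. *)
have comb : (1 - b) * inner (G hx) (x - hx) + b * inner (G hx) (z - hx) =
    b * inner (G hx) (y' - y) - b * inner (G hx) (y' - z).
  rewrite /hx !innerE; ring.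
(* The gradient is the sampled direction plus its error. The error against [y - z] survives in the
   final bound, the error against [y' - y] is left for Young's inequality. *)
have split_d : inner (G hx) (y' - z) =
    inner d (y' - z) + inner delta (y - z) + inner delta (y' - y).
  rewrite /delta !innerE; ring.
have tp := three_point y y' z Hs.
have split_o : inner (d + h + gam *: (H *m (y' - y)) + M *m (y' - x0)) (z - y') =
    - inner d (y' - z) + inner (h + M *m (y' - x0)) (z - y')
    + gam / 2 * (sqnorm H (z - y) - sqnorm H (z - y') - sqnorm H (y' - y)).
  rewrite -tp -[y' - z]opprB innerNr opprK; move: (H *m _) (M *m _) => a c.
  by rewrite !innerDl innerZl; field.
rewrite split_o in O; rewrite split_d in comb.
rewrite /= in C; rewrite -/delta /gap /=; lra.
Qed.

End ProximalStep.

(** * Weighted telescoping over the inner loop *)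

Lemma weighted_step_arith (R : realFieldType) (T eta nu a a' i1 i2 P Q r D : R) :
  0 < T -> 0 < eta -> 0 <= nu -> eta * nu < 1 -> 0 <= r ->
  a' <= (1 - 2 / (T + 1)) * a
        + 2 / (T + 1) * (i1 + i2 + 2 / (T * eta) / 2 * (P - Q - r))
        + nu / 2 * (2 / (T + 1)) ^+ 2 * r ->
  T * i2 <= (1 - eta * nu) / eta * r + (4 * ((1 - eta * nu) / eta))^-1 * D ->
  T * (T + 1) / 2 * a' <= (T - 1) * T / 2 * a + T * i1
     + eta / (4 * (1 - eta * nu)) * D + 1 / eta * (P - Q).
Proof.
move=> T0 e0 nu0 enu r0 step young.
(* The weight [T (T + 1) / 2] makes the old gap's coefficient [(T - 1) T / 2], the previous step's
   weight, and the proximal coefficient [1 / eta], free of [T]. *)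
have K0 : 0 <= T * (T + 1) / 2 by nra.
have := ler_wpM2l K0 step.
have -> : T * (T + 1) / 2 * ((1 - 2 / (T + 1)) * a
        + 2 / (T + 1) * (i1 + i2 + 2 / (T * eta) / 2 * (P - Q - r))
        + nu / 2 * (2 / (T + 1)) ^+ 2 * r) =
  (T - 1) * T / 2 * a + T * i1 + T * i2 + 1 / eta * (P - Q - r) + T / (T + 1) * (nu * r).
  by field; lra.
(* After this rounding, [r] has total coefficient [nu - 1 / eta], which exactly cancels the first
   Young term. *)
have : T / (T + 1) * (nu * r) <= nu * r.
  by rewrite ler_piMl ?mulr_ge0 // ler_pdivrMr; lra.
have cE : (1 - eta * nu) / eta * r = 1 / eta * r - nu * r by field; lra.
have DE : (4 * ((1 - eta * nu) / eta))^-1 = eta / (4 * (1 - eta * nu)).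
  by field; rewrite !gt_eqF //; lra.
rewrite {}cE {}DE in young; lra.
Qed.

(** Induction on the number of inner steps. The weight of the gap at the starting point is zero, so
    that gap never enters. The direction [d] is an arbitrary sequence: the estimate is pathwise and
    takes no expectation. *)
Lemma xsub_gap_bound (R : realType) (p : nat) (X : set 'cV[R]_p)
    (F : 'cV[R]_p -> R) (G : 'cV[R]_p -> 'cV[R]_p) (H M : 'M[R]_p)
    (nu eta : R) (h x0 z : 'cV[R]_p) (d x y : nat -> 'cV[R]_p) (m : nat) :
  convex_set X -> symmetric_mx H -> posdef_mx H ->
  symmetric_mx M -> psd_mx M ->
  (forall a c, X a -> X c ->
     F c <= F a + inner (G a) (c - a) + nu / 2 * sqnorm H (c - a)) ->
  (forall a c, X a -> X c -> F a + inner (G a) (c - a) <= F c) ->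
  0 < eta -> 0 < nu -> eta * nu < 1 ->
  X z -> (forall t, (1 <= t <= m.+1)%N -> X (x t) /\ X (y t)) ->
  let b := fun t : nat => 2 / (t%:R + 1) : R in
  (forall t w, (1 <= t <= m)%N -> X w ->
     let obj := fun w => inner (d t + h) w
       + 2 / (t%:R * eta) / 2 * sqnorm H (w - y t) + 1 / 2 * sqnorm M (w - x0) in
     obj (y t.+1) <= obj w) ->
  (forall t, (1 <= t <= m)%N -> x t.+1 = b t *: y t.+1 + (1 - b t) *: x t) ->
  let delta := fun t => G (b t *: y t + (1 - b t) *: x t) - d t in
  let gap := fun w => F w - F z - inner (h + M *m (w - x0)) (z - w) in
  m%:R * (m%:R + 1) / 2 * gap (x m.+1) <=
    \sum_(1 <= t < m.+1) t%:R * inner (delta t) (y t - z)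
    + eta / (4 * (1 - eta * nu)) *
      \sum_(1 <= t < m.+1) t%:R ^+ 2 * sqnorm (invmx H) (delta t)
    + 1 / eta * (sqnorm H (z - y 1%N) - sqnorm H (z - y m.+1)).
Proof.
move=> cX Hs Hpd Ms Mpsd smooth tangent e0 nu0 enu Xz.
elim: m => [|m IH] Xxy b ymin xS; set delta := fun t => _; set gap := fun w => _.
  by rewrite /= !big_geq // mulr0 !mul0r subrr mulr0 !addr0.
have IHm : m%:R * (m%:R + 1) / 2 * gap (x m.+1) <=
    \sum_(1 <= t < m.+1) t%:R * inner (delta t) (y t - z)
    + eta / (4 * (1 - eta * nu)) *
      \sum_(1 <= t < m.+1) t%:R ^+ 2 * sqnorm (invmx H) (delta t)
    + 1 / eta * (sqnorm H (z - y 1%N) - sqnorm H (z - y m.+1)).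
  apply: IH => [t /andP[t1 tm]|t w /andP[t1 tm]|t /andP[t1 tm]].
  - by apply: Xxy; rewrite t1 (leq_trans tm).
  - by apply: ymin; rewrite t1 (leq_trans tm).
  - by apply: xS; rewrite t1 (leq_trans tm).
have m1 : (1 <= m.+1 <= m.+1)%N by rewrite leqnn.
have [Xx Xy] : X (x m.+1) /\ X (y m.+1) by apply: Xxy; rewrite leqnSn.
have [_ Xy'] : X (x m.+2) /\ X (y m.+2) by apply: Xxy; rewrite leqnn.
have T0 : 0 < m.+1%:R :> R by rewrite ltr0n.
have b0 : 0 <= b m.+1 by rewrite /b divr_ge0 //; lra.
have b1 : b m.+1 <= 1.
  have T1 : 1 <= m.+1%:R :> R by rewrite ler1n.
  by rewrite /b ler_pdivrMr; lra.
have step := accelerated_step cX Hs Ms Mpsd smooth tangent b0 b1 Xx Xy Xy' Xz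
  (fun w => ymin _ w m1).
have c0 : 0 < (1 - eta * nu) / eta by rewrite divr_gt0 //; lra.
(* Scaling the error by the step index before applying Young's inequality yields the squared weights
   of the last sum. *)
have young := inner_young (m.+1%:R *: delta m.+1) (y m.+2 - y m.+1) Hs Hpd c0.
rewrite innerZl sqnormZ in young.
have := weighted_step_arith T0 e0 (ltW nu0) enu (posdef_psd Hpd _) step young.
rewrite /= -xS // -/(gap _) -/(gap _) -/(delta _) => main.
rewrite !(big_nat_recr m.+1) //=.
(* This identifies [(T - 1) T / 2] with the weight in the induction hypothesis. *)
have mE : m.+1%:R = m%:R + 1 :> R by rewrite -natr1.
rewrite mE addrK in main; rewrite mE.
lra.
Qed.

(** * Averaging over components and the primal-dual identity *)

Lemma mean_ler (R : realFieldType) (N : nat) (u v : 'I_N -> R) (K : R) :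
  (0 < N)%N -> (forall j, u j <= v j + K) ->
  N%:R^-1 * (\sum_j u j) <= N%:R^-1 * (\sum_j v j) + K.
Proof.
move=> N0 uv; have N0R : N%:R != 0 :> R by rewrite pnatr_eq0 -lt0n.
rewrite -[X in _ <= _ + X](mulKf N0R) -mulrDr ler_wpM2l ?invr_ge0 //.
rewrite mulr_natl -[X in K *+ X]card_ord -sumr_const -big_split /=.
exact: ler_sum.
Qed.

(** Since [(lam - lamt) / beta] is the residual at [x'], the dual block reduces [A z - b] to
    [A (z - x')], and [mu] cancels. The part [- beta A^T A] of the primal block then moves the
    multiplier's residual from [x'] back to [x], giving the vector [h] of the subroutine. *)
Lemma saddle_inner_identity (R : realType) (p q : nat) (A : 'M[R]_(q, p))
    (M : 'M[R]_p) (b lam mu : 'cV[R]_q) (beta : R) (z x x' : 'cV[R]_p) :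
  beta != 0 ->
  let lamt := lam - beta *: (A *m x' - b) in
  let wt := col_mx x' lamt in
  let w := col_mx z mu in
  inner (w - wt) (col_mx (- (A^T *m mu)) (A *m z - b))
  - ((w - wt)^T *m block_mx (M - beta *: (A^T *m A)) 0 0 (beta^-1)%:M
      *m (col_mx x lam - wt)) 0 0
  = inner (- (A^T *m (lam - beta *: (A *m x - b))) + M *m (x' - x)) (z - x').
Proof.
move=> beta0 lamt wt w.
rewrite -mulmxA -/(inner _ _) /w /wt !opp_col_mx !add_col_mx mul_block_col.
rewrite !mul0mx add0r addr0 mul_scalar_mx !inner_col_mx.
have -> : lam - lamt = beta *: (A *m x' - b) by rewrite /lamt opprB addrC subrK.
rewrite scalerA mulVf // scale1r.
set e := z - x'.
have AtE v : inner e (A^T *m v) = inner (A *m e) v.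
  by rewrite inner_mulmxr trmxK.
have Ae : A *m z - b = A *m e + (A *m x' - b).
  by rewrite /e mulmxBr addrA subrK.
rewrite Ae [RHS]innerC mulmxBl -scalemxAl -mulmxA.
rewrite !(innerDr, innerNr, innerZr, AtE) (innerC (mu - lamt) (A *m e)).
rewrite -[in RHS](opprB x x') mulmxN innerNr /lamt !mulmxBr.
rewrite !(innerDr, innerNr, innerZr); ring.
Qed.

(** * Assembly for the AS-ALM iterates *)

Unset Implicit Arguments.
Set Strict Implicit.

Theorem theorem4p2 (R : realType) (n1 n N : nat)
  (X : set 'cV[R]_n1) (A : 'M[R]_(n, n1)) (b : 'cV[R]_n)
  (fj : 'I_N -> 'cV[R]_n1 -> R) (gradfj : 'I_N -> 'cV[R]_n1 -> 'cV[R]_n1)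
  (U : set 'cV[R]_n1) (H : 'M[R]_n1) (nu : R)
  (beta s : R)
  (m : nat -> nat) (eta : nat -> R) (M : nat -> 'M[R]_n1)
  (x bx : nat -> 'cV[R]_n1) (lam : nat -> 'cV[R]_n)
  (xi : nat -> nat -> 'I_N) (e : nat -> nat -> 'cV[R]_n1)
  (xin bxin : nat -> nat -> 'cV[R]_n1)
  (k : nat) :
  (* problem data *)
  (0 < N)%N ->
  X !=set0 -> closed X -> convex_set X ->
  open U -> X `<=` U ->
  (forall j, convex_fun_on X (fj j)) ->
  (forall j, C1_with_grad U (fj j) (gradfj j)) ->
  symmetric_mx H -> posdef_mx H -> 0 < nu ->
  (forall j x1 x2, X x1 -> X x2 ->
     mnorm (invmx H) (gradfj j x1 - gradfj j x2) <= nu * mnorm H (x1 - x2)) ->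
  let f := fun z => N%:R^-1 * \sum_(j < N) fj j z in
  let gradf := fun z => N%:R^-1 *: \sum_(j < N) gradfj j z in
  (* AS-ALM parameters *)
  0 < beta -> 0 < s -> s <= 2 ->
  (forall l, (1 <= m l)%N) -> (forall l, 0 < eta l) ->
  (forall l, symmetric_mx (M l)) ->
  (forall l, psd_mx (M l - beta *: (A^T *m A))) ->
  (* initialization *)
  X (x 0%N) -> bx 0%N = x 0%N ->
  (* outer iterations *)
  (forall l, xin l 1%N = x l /\ bxin l 1%N = bx l) ->
  (forall l, x l.+1 = xin l (m l).+1 /\ bx l.+1 = bxin l (m l).+1) ->
  (forall l, lam l.+1 = lam l - (s * beta) *: (A *m x l.+1 - b)) ->
  (* inner iterations of xsub with h = h^l *)
  (forall l t, (1 <= t <= m l)%N ->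
     let h := - (A^T *m (lam l - beta *: (A *m x l - b))) in
     let beta_t := 2 / (t%:R + 1) in
     let gamma_t := 2 / (t%:R * eta l) in
     let hx := beta_t *: bxin l t + (1 - beta_t) *: xin l t in
     let d := gradfj (xi l t) hx + e l t in
     let obj := fun z => inner (d + h) z + gamma_t / 2 * sqnorm H (z - bxin l t)
                         + 1 / 2 * sqnorm (M l) (z - x l) in
     X (bxin l t.+1) /\ (forall z, X z -> obj (bxin l t.+1) <= obj z) /\
     xin l t.+1 = beta_t *: bxin l t.+1 + (1 - beta_t) *: xin l t) ->
  (* the claim at iteration k *)
  0 < eta k -> eta k < 1 / nu ->
  let mk := m k in
  let hx := fun t : nat =>
     (2 / (t%:R + 1)) *: bxin k t + (1 - 2 / (t%:R + 1)) *: xin k t in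
  let delta := fun t : nat => gradf (hx t) - (gradfj (xi k t) (hx t) + e k t) in
  let zeta := fun z : 'cV[R]_n1 =>
     2 / (mk%:R * (mk%:R + 1)) *
       (1 / eta k * (sqnorm H (z - bx k.+1) - sqnorm H (z - bx k))
        - \sum_(1 <= t < mk.+1) t%:R * inner (delta t) (bxin k t - z)
        - eta k / (4 * (1 - eta k * nu)) *
            \sum_(1 <= t < mk.+1) t%:R ^+ 2 * sqnorm (invmx H) (delta t)) in
  let lamt := lam k - beta *: (A *m x k.+1 - b) in
  let wt : 'cV[R]_(n1 + n) := col_mx (x k.+1) lamt in
  let wk : 'cV[R]_(n1 + n) := col_mx (x k) (lam k) in
  let Dk := M k - beta *: (A^T *m A) in
  let Qk : 'M[R]_(n1 + n) := block_mx Dk 0 0 (beta^-1)%:M in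
  let J := fun (z : 'cV[R]_n1) (mu : 'cV[R]_n) =>
     (col_mx (- (A^T *m mu)) (A *m z - b) : 'cV[R]_(n1 + n)) in
  X (x k.+1) /\
  forall (z : 'cV[R]_n1) (mu : 'cV[R]_n), X z ->
    let w : 'cV[R]_(n1 + n) := col_mx z mu in
    f z - f (x k.+1) + inner (w - wt) (J z mu)
      >= ((w - wt)^T *m Qk *m (wk - wt)) 0 0 + zeta z.
Proof.
move=> N0 _ _ cX _ XU cfj gj Hs Hpd nu0 lip f gradf beta0 _ _ m1 eta0 Ms Dpsd.
move=> Xx0 bx0 xin1 xout _ inner_it etak0 etak mk hx delta zeta lamt wt wk Dk Qk J.
(* Inner indices start at 1, where [2 / (t + 1)] equals 1 and after which it decreases, so each
   update is a convex combination. *)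
have Xin l : X (x l) -> X (bx l) -> forall t, (1 <= t <= (m l).+1)%N ->
    X (xin l t) /\ X (bxin l t).
  move=> Xx Xbx; elim=> [//|[|t] IH] tm; first by have [-> ->] := xin1 l.
  have tm' : (1 <= t.+1 <= m l)%N by [].
  have [Xxt Xbt] := IH (ltnW tm).
  have [Xb [_ ->]] := inner_it l t.+1 tm'; split => //.
  have T0 : 0 <= t%:R :> R by [].
  by apply: convex_set_comb; rewrite // -?natr1 ?divr_ge0 ?ler_pdivrMr; lra.
(* Both sequences go through the induction together, because the proximal centre is carried over
   between outer iterations. *)
have Xout l : X (x l) /\ X (bx l).
  elim: l => [|l [Xx Xbx]]; first by rewrite bx0.
  by have [-> ->] := xout l; apply: Xin => //; rewrite ltnS leqnn.
have enu : eta k * nu < 1 by rewrite -ltr_pdivlMr.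
(* Both first-order bounds are averaged from the components, so f itself is never differentiated. *)
have smooth a c : X a -> X c ->
    f c <= f a + inner (gradf a) (c - a) + nu / 2 * sqnorm H (c - a).
  move=> Xa Xc; rewrite /f /gradf innerZl inner_suml -mulrDr -big_split /=.
  apply: mean_ler => // j.
  exact: smooth_quadratic_bound cX XU (gj j) Hs Hpd nu0 (lip j) Xa Xc.
have tangent a c : X a -> X c -> f a + inner (gradf a) (c - a) <= f c.
  move=> Xa Xc; rewrite /f /gradf innerZl inner_suml -mulrDr -big_split /=.
  rewrite -[leRHS]addr0; apply: mean_ler => // j; rewrite addr0.
  exact: convex_above_tangent XU (gj j) (cfj j) Xa Xc.
(* [M k] is the sum of the semidefinite [Dk] and [beta A^T A]. *)
have Mpsd : psd_mx (M k).
  move=> v; rewrite -[M k](subrK (beta *: (A^T *m A))) sqnormDl addr_ge0 //.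
    exact: Dpsd.
  rewrite sqnormE -scalemxAl innerZr -mulmxA inner_mulmxr trmxK.
  by rewrite mulr_ge0 ?inner_ge0 // ltW.
split=> [|z mu Xz]; first by case: (Xout k.+1).
cbv zeta; set w := col_mx z mu.
have [Xxk Xbxk] := Xout k.
have := xsub_gap_bound (d := fun t => gradfj (xi k t) (hx t) + e k t)
  cX Hs Hpd (Ms k) Mpsd smooth tangent (eta0 k) nu0 enu Xz (Xin k Xxk Xbxk)
  (fun t u tm Xu => (inner_it k t tm).2.1 u Xu)
  (fun t tm => (inner_it k t tm).2.2).
rewrite /= -(xout k).1 -(xout k).2 (xin1 k).2.
have mk0 : 0 < mk%:R :> R by rewrite ltr0n; exact: m1.
have := saddle_inner_identity A (M k) b (lam k) mu z (x k) (x k.+1) (lt0r_neq0 beta0).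
rewrite /= -/lamt -/wt -/w -/(J z mu) -/Dk -/Qk -/wk => saddle gap_bound.
(* By [saddle], the inner product here is the variational term minus the [Qk] term; the right-hand
   side is minus the gap at [x k.+1]. *)
suff : zeta z <= f z - f (x k.+1)
    + inner (- (A^T *m (lam k - beta *: (A *m x k - b)))
             + M k *m (x k.+1 - x k)) (z - x k.+1).
  by rewrite -saddle; lra.
(* The prefactor of [zeta] is the inverse of the telescoping weight; clearing it leaves the negated
   gap bound. *)
rewrite /zeta -[2 / _]invf_div ler_pdivrMl ?divr_gt0 ?mulr_gt0 ?addr_gt0 //.
move: gap_bound; rewrite -/mk -/(hx _); lra.
Qed.
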